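(* For every $n\ge 1$, the number $C(n)$ of complement two-cycles of the Pulse update on the complete directed loopless graph $K_n^\rightarrow$ is $$C(n)=\frac{1}{2}\sum_{\substack{0\leq m\leq n\\ m\text{ prime}\\ n-m\text{ prime}\\ m\neq 3,\ n-m\neq 3}}\binom{n}{m}.$$
   Context: $K_n^\rightarrow$ denotes the complete directed graph on $n$ vertices (vertex set $V$) with no self-loops: for every pair of vertices $u\neq v$ the edge $u\to v$ is present. The Pulse update on a loopless directed graph $(V,E)$ acts on states $x_t:V\to\{0,1\}$ synchronously: with $k_t(v)=\sum_{u:(u,v)\in E}x_t(u)$, one sets $x_{t+1}(v)=1$ if $k_t(v)$ is a prime number and $x_{t+1}(v)=0$ otherwise. States are identified with their active sets $\{v\in V:x_t(v)=1\}\subseteq V$. A complement two-cycle is a periodic orbit consisting of two states $S$ and $V\setminus S$, where $S$ is mapped to $V\setminus S$ and $V\setminus S$ is mapped to $S$; it is counted once as the unordered pair $\{S,V\setminus S\}$. $C(n)$ is the number of complement two-cycles of $K_n^\rightarrow$ (vertices are labeled). *)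

(* Defs.v *)
From mathcomp Require Import all_boot all_order all_algebra.

Set Implicit Arguments.
Unset Strict Implicit.
Unset Printing Implicit Defensive.

(* A directed graph on V is its adjacency relation: E u v is the edge u -> v. *)

Definition state (V : finType) := {ffun V -> bool}.

Definition active_in_neighbours (V : finType) (E : rel V) (x : state V) (v : V)
  : nat := \sum_(u | E u v) x u.

Definition pulse (V : finType) (E : rel V) (x : state V) : state V :=
  [ffun v => prime (active_in_neighbours E x v)].

Definition active_set (V : finType) (x : state V) : {set V} := [set v | x v].

Definition state_of_set (V : finType) (S : {set V}) : state V :=
  [ffun v => v \in S].

(* The Pulse update through the identification of states with active sets. *)
Definition pulse_set (V : finType) (E : rel V) (S : {set V}) : {set V} :=
  active_set (pulse E (state_of_set S)).

(* Each cycle is the unordered pair {S, V \ S}.  The condition S != ~: S says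
   that the orbit has two states; it can only fail when V is empty. *)
Definition complement_two_cycles (V : finType) (E : rel V)
  : {set {set {set V}}} :=
  [set P : {set {set V}} |
    [exists S : {set V},
      [&& P == [set S; ~: S], S != ~: S,
          pulse_set E S == ~: S & pulse_set E (~: S) == S]]].

Definition complete_digraph (n : nat) : rel 'I_n := [rel u v | u != v].

Definition num_complement_two_cycles (n : nat) : nat :=
  #|complement_two_cycles (@complete_digraph n)|.

(* Main.v *)
Require Import Defs.
From mathcomp Require Import all_boot all_order all_algebra.
From mathcomp Require Import zify.
Import GRing.Theory.
Local Open Scope ring_scope.

(** On the complete loopless digraph a vertex [v] sees every active vertex but
    itself, so it becomes active iff [#|S :\ v|] is prime.  Hence a set [S] that
    is neither empty nor full is mapped to its complement iff [#|S|] is prime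
    (asked by the vertices outside [S]) and [#|S| - 1] is not (asked by the
    vertices inside).  The only two consecutive primes are 2 and 3, so for a
    prime [#|S|] the second condition says that [#|S|] is not 3.  The empty set
    and the full set never take part: the vertices outside the empty one of the
    two would need 0 to be prime.  Asking the same of the complement leaves a
    condition on [#|S|] alone, [pulse_set_swapE].

    There are ['C(n, m)] sets of each size [m], and every unordered pair
    [{S, ~: S}] comes from exactly two of the sets counted,
    [card_complement_pairs]; this is the factor 1/2. *)

Definition swap_size (n m : nat) : bool :=
  [&& prime m, prime (n - m)%N, m != 3%N & (n - m)%N != 3%N].

Lemma prime_pred (p : nat) : prime p -> prime p.-1 = (p == 3%N).
Proof.
move=> pr_p; apply/idP/eqP=> [pr_p1 | -> //].
have [p_gt1 p1_gt1] := (prime_gt1 pr_p, prime_gt1 pr_p1).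
(* Of two consecutive numbers one is even, and 2 is the only even prime. *)
case: (even_prime pr_p) => [p2 | odd_p]; first by rewrite p2 in p1_gt1.
case: (even_prime pr_p1) => [p12 | odd_p1]; first by lia.
by lia.
Qed.

Lemma mem_pulse_complete (n : nat) (S : {set 'I_n}) (v : 'I_n) :
  (v \in pulse_set (@complete_digraph n) S) = prime #|S :\ v|.
Proof.
rewrite inE ffunE /active_in_neighbours; congr prime.
rewrite -sum1_card big_mkcond [RHS]big_mkcond /=.
apply: eq_bigr => u _; rewrite /complete_digraph ffunE !inE /=.
by case: (u != v); case: (u \in S).
Qed.

(** Each of the two conditions is imposed by the vertices of one side, hence
    only when that side is nonempty. *)
Lemma pulse_set_eqC (n : nat) (S : {set 'I_n}) :
  reflect ((S != set0 -> ~~ prime #|S|.-1) /\ (~: S != set0 -> prime #|S|))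
          (pulse_set (@complete_digraph n) S == ~: S).
Proof.
have in_S v : v \in S -> #|S :\ v| = #|S|.-1.
  by move=> vS; rewrite (cardsD1 v S) vS.
have out_S v : v \notin S -> #|S :\ v| = #|S|.
  by move=> vS; rewrite [RHS](cardsD1 v S) (negbTE vS).
apply: (iffP eqP) => [eS | [inP outP]].
  have eV v : (v \notin S) = prime #|S :\ v|.
    by rewrite -mem_pulse_complete eS inE.
  split=> /set0Pn [v]; first by move=> vS; rewrite -(in_S v vS) -eV vS.
  by rewrite inE => vS; rewrite -(out_S v vS) -eV.
apply/setP=> v; rewrite mem_pulse_complete inE.
have [vS | vS] := boolP (v \in S).
  by rewrite in_S //; apply/negbTE/inP/set0Pn; exists v.
by rewrite out_S //; apply/outP/set0Pn; exists v; rewrite inE.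
Qed.

(** The empty graph is a genuine exception: there the empty set is its own
    complement and is swapped with itself. *)
Lemma pulse_set_swapE (n : nat) (S : {set 'I_n}) : (0 < n)%N ->
  (pulse_set (@complete_digraph n) S == ~: S) &&
  (pulse_set (@complete_digraph n) (~: S) == S) = swap_size n #|S|.
Proof.
move=> n_gt0.
have cC : #|~: S| = (n - #|S|)%N.
  by rewrite [#|S|]cardsCs card_ord subKn // -[n in (_ <= n)%N]card_ord max_card.
have nzE (T : {set 'I_n}) : prime #|T| -> T != set0.
  by rewrite -card_gt0; apply: prime_gt0.
rewrite -{4}[S]setCK /swap_size -cC.
apply/andP/and4P=> [[/pulse_set_eqC [inS outS] /pulse_set_eqC [inC outC]] | ].
  rewrite setCK in outC.
  (* As the graph is not empty, S or its complement is not empty.  The vertices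
     of that side make the size of the other side prime, so the other side is
     nonempty too and makes the size of the first one prime. *)
  have [pS pC] : prime #|S| /\ prime #|~: S|.
    have [S0 | S_n0] := eqVneq S set0; last first.
      have pC := outC S_n0.
      by split=> //; apply/outS/nzE.
    suff pS : prime #|S| by split=> //; apply/outC/nzE.
    by apply: outS; rewrite S0 setC0 -card_gt0 cardsT card_ord.
  split=> //; first by rewrite -prime_pred // inS // nzE.
  by rewrite -prime_pred // inC // nzE.
case=> pS pC S3 C3.
by split; apply/pulse_set_eqC; split=> _; rewrite ?setCK ?prime_pred.
Qed.

Lemma set_neqC (T : finType) (S : {set T}) : (0 < #|T|)%N -> S != ~: S.
Proof.
case/card_gt0P => x _; apply/eqP => /setP /(_ x).
by rewrite inE; case: (x \in S).
Qed.

(** Choosing a set among those of a good size is choosing a size and then a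
    set of that size. *)
Lemma card_sets_by_size (T : finType) (P : pred nat) :
  #|[set S : {set T} | P #|S|]| =
  (\sum_(0 <= m < #|T|.+1 | P m) 'C(#|T|, m))%N.
Proof.
rewrite -sum1dep_card big_mkord.
rewrite (partition_big (fun S : {set T} => inord #|S| : 'I_#|T|.+1)
           (fun m : 'I_#|T|.+1 => P m)) /=; last first.
  by move=> S; rewrite inordK // ltnS max_card.
apply: eq_bigr => m Pm; rewrite -card_draws -sum1dep_card.
apply: eq_bigl => S.
rewrite -(inj_eq val_inj) /= inordK ?ltnS ?max_card //.
by case: eqP => [-> | _]; rewrite ?Pm ?andbF.
Qed.

(** The pair of [S] comes only from [S] and [~: S].  Both are in [A] by
    closure, and they differ because [T] is inhabited. *)
Lemma card_complement_pairs (T : finType) (A : {set {set T}}) :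
    (0 < #|T|)%N -> (forall S, (~: S \in A) = (S \in A)) ->
  #|A| = (2 * #|[set [set S; ~: S] | S in A]|)%N.
Proof.
move=> T_gt0 A_C.
rewrite -sum1_card (partition_big_imset (fun S : {set T} => [set S; ~: S])) /=.
rewrite mulnC -sum_nat_const; apply: eq_bigr => _ /imsetP [S SA ->].
have <- : #|[set S; ~: S]| = 2%N by rewrite cards2 set_neqC.
rewrite sum1_card; apply: eq_card => U; rewrite [LHS]inE /=.
apply/andP/idP => [[_ /eqP <-] | /set2P [] ->]; first exact: set21.
  by rewrite SA.
by rewrite A_C SA setCK setUC.
Qed.

Theorem proposition16 (n : nat) (hn : (1 <= n)%N) :
  (num_complement_two_cycles n)%:R =
    1 / 2 * \sum_(0 <= m < n.+1 | [&& prime m, prime (n - m)%N,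
                                     m != 3%N & (n - m)%N != 3%N])
              ('C(n, m))%:R :> rat.
Proof.
pose A := [set S : {set 'I_n} | swap_size n #|S|].
have A_C S : (~: S \in A) = (S \in A).
  by rewrite !inE -!pulse_set_swapE // setCK andbC.
have cyclesE : complement_two_cycles (@complete_digraph n) =
               [set [set S; ~: S] | S in A].
  apply/setP=> P; rewrite inE; apply/existsP/imsetP.
    case=> S /and4P [/eqP -> _ sw1 sw2]; exists S => //.
    by rewrite inE -pulse_set_swapE // sw1.
  case=> S; rewrite inE -pulse_set_swapE // => /andP [sw1 sw2] ->.
  by exists S; rewrite eqxx sw1 sw2 set_neqC ?card_ord.
have two_cycles : #|A| = (2 * num_complement_two_cycles n)%N.
  by rewrite /num_complement_two_cycles cyclesE -card_complement_pairs ?card_ord.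
have cardA := card_sets_by_size 'I_n (swap_size n).
rewrite card_ord in cardA.
rewrite -natr_sum -[X in X%:R = _ * _]/(num_complement_two_cycles n).
by rewrite -[X in _ * X%:R]cardA -/A two_cycles natrM mul1r mulKf.
Qed.
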